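(* Suppose that $v(c)<\nu_\infty$ and $v(a)>v(c)$ and $\mu_\ell\subseteq K$. Let $n\ge 0$ be an integer. Then: (a) The group $G(n)$ is isomorphic to a subgroup of $(\mathbb{Z}/\ell\mathbb{Z})^n$. (b) If the residue field of $K$ is finite, then the group $G(n)/I(n)$ is cyclic of order dividing $\ell$. (c) For any $\alpha_n\in f^{-n}(a)$, we have $K_n=K(\alpha_n)$.
   Context: $K$ is a field complete with respect to a discrete valuation $v$, with residue field of characteristic $p$ (possibly $0$); $v$ is extended to an algebraic closure $\overline{K}$. $f(z)=z^\ell-c\in K[z]$ with $\ell\ge 2$ an integer and $c\in K^\times$, and one of the following cases holds: (tame case) $\ell$ is not divisible by $p$; (wild case) $\ell=p$ and $K$ is a finite extension of $\mathbb{Q}_p$, with $v$ normalized so that $v(p)=1$. $\nu_\infty=-\frac{\ell}{\ell-1}v(\ell)$ (so $\nu_\infty=0$ in the tame case and $\nu_\infty=-\frac{p}{p-1}$ in the wild case). $f^n$ is the $n$-th iterate of $f$; $a\in K$ is such that for every $n\ge0$ the solutions of $f^n(z)=a$ in $\overline{K}$ are distinct; $f^{-n}(a)$ is the set of these solutions; $K_n=K(f^{-n}(a))$; $G(n)=\mathrm{Aut}(K_n/K)=\mathrm{Gal}(K_n/K)$; $I(n)$ is the inertia subgroup of $G(n)$. $\mu_\ell$ is the group of $\ell$-th roots of unity in $\overline{K}$. *)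

(* Defs.v *)
From HB Require Import structures.
From mathcomp Require Import all_boot all_order all_fingroup all_algebra all_solvable all_field.
From mathcomp Require Import boolp classical_sets cardinality reals constructive_ereal.

Set Implicit Arguments.
Unset Strict Implicit.
Unset Printing Implicit Defensive.
Import Order.TTheory GRing.Theory Num.Theory.
Local Open Scope ring_scope.

Record valuation (R : realType) (F : fieldType) := Valuation {
  valf :> F -> \bar R;
  valf_eqy : forall x, valf x = +oo%E <-> x = 0;
  valf_neqNy : forall x, valf x <> -oo%E;
  valfM : forall x y, valf (x * y) = (valf x + valf y)%E;
  valfD : forall x y, (Order.min (valf x) (valf y) <= valf (x + y)%R)%E
}.

Arguments valf_eqy {R F} _ _.
Arguments valf_neqNy {R F} _ _.

Section ValuationTheory.
Context {R : realType} {F : fieldType}.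
Implicit Type v : valuation R F.
Local Open Scope ereal_scope.

Lemma valf0 v : v 0%R = +oo. Proof. by apply/valf_eqy. Qed.

Lemma valf1 v : v 1%R = 0.
Proof.
have := valfM v 1%R 1%R; rewrite mulr1.
have := valf_neqNy v 1%R.
have : v 1%R <> +oo by move=> /valf_eqy/eqP; rewrite oner_eq0.
case: (v 1%R) => [r| |] // _ _ [] /eqP.
by rewrite -subr_eq0 opprD addNKr oppr_eq0 => /eqP ->.
Qed.

Lemma valfN v x : v (- x)%R = v x.
Proof.
have vN1 : v (- 1)%R = 0.
  have := valfM v (- 1)%R (- 1)%R; rewrite mulrNN mulr1 valf1.
  case: (v (- 1)%R) => [r| |] // [] /esym/eqP.
  by rewrite -mulr2n mulrn_eq0 /= => /eqP ->.
by rewrite -mulN1r valfM vN1 add0e.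
Qed.

Lemma valfB_ge v t x y : t <= v x -> t <= v y -> t <= v (x - y)%R.
Proof.
move=> tx ty; apply: le_trans (valfD v _ _).
by rewrite le_min tx valfN.
Qed.

Lemma valfB_gt v t x y : t < v x -> t < v y -> t < v (x - y)%R.
Proof.
move=> tx ty; apply: lt_le_trans (valfD v _ _).
by rewrite lt_min tx valfN.
Qed.

Definition vring_pred v : {pred F} := fun x => 0 <= v x.

Lemma vring_subring v : subring_closed (vring_pred v).
Proof.
split=> [|x y|x y]; rewrite /vring_pred !unfold_in /=.
- by rewrite valf1.
- exact: valfB_ge.
- by move=> x0 y0; rewrite valfM adde_ge0.
Qed.

HB.instance Definition _ v :=
  GRing.isSubringClosed.Build F (vring_pred v) (vring_subring v).

Record vring v := VRing { vring_val :> F; _ : vring_val \in vring_pred v }.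

HB.instance Definition _ v := [isSub for (@vring_val v)].
HB.instance Definition _ v := [Choice of vring v by <:].
HB.instance Definition _ v := [SubChoice_isSubComNzRing of vring v by <:].

Definition vmax v : {pred vring v} := fun x => 0 < v (vring_val x).
Arguments vmax : clear implicits.

Lemma vmaxE v (x : vring v) : (x \in vmax v) = (0 < v (vring_val x)).
Proof. by []. Qed.

Lemma vmax_idealr v : idealr_closed (vmax v).
Proof.
split=> [||x y z]; rewrite !vmaxE.
- by rewrite valf0 ltry.
- by rewrite valf1 ltxx.
- move=> y0 z0; have x0 : 0 <= v (vring_val x) by case: x.
  have xy0 : 0 < v (vring_val x * vring_val y)%R.
    by rewrite valfM; apply: lt_le_trans y0 _; rewrite leeDr.
  apply: lt_le_trans (valfD v _ _).
  by rewrite lt_min; apply/andP; split.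
Qed.

HB.instance Definition _ v := isIdealr.Build (vring v) (vmax v) (vmax_idealr v).

(* The residue field, with only its commutative ring structure recorded. *)
Definition residue v : comNzRingType := {ideal_quot (vmax v)}.

Definition residue_char v (p : nat) : Prop :=
  (p = 0%N /\ [pchar (residue v)] =i pred0) \/ p \in [pchar (residue v)].

(* The value group is infinite cyclic, but not required to be Z: the wild case
   uses the normalization [v p = 1], with ramification allowed. *)
Definition discrete v : Prop :=
  exists2 r : R, (0 < r)%R &
    (exists x, v x = r%:E) /\
    (forall x, x != 0%R -> exists m : int, v x = (r *~ m)%:E).

Definition complete v : Prop :=
  forall u : nat -> F,
    (forall B : R, exists N, forall i j, (N <= i)%N -> (N <= j)%N ->
       B%:E < v (u i - u j)%R) ->
    exists l : F, forall B : R, exists N, forall i, (N <= i)%N ->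
      B%:E < v (u i - l)%R.

End ValuationTheory.
Arguments vmax {R F} v _.

Section RestrictValuation.
Context {R : realType} {E F : fieldType} (w : valuation R F) (j : {rmorphism E -> F}).

Lemma restr_eqy x : w (j x) = +oo%E <-> x = 0.
Proof.
split=> [/valf_eqy/eqP|->]; first by rewrite fmorph_eq0 => /eqP.
by rewrite rmorph0 valf0.
Qed.

Lemma restrM x y : w (j (x * y)) = (w (j x) + w (j y))%E.
Proof. by rewrite rmorphM valfM. Qed.

Lemma restrD x y : (Order.min (w (j x)) (w (j y)) <= w (j (x + y)%R))%E.
Proof. by rewrite rmorphD valfD. Qed.

Definition restrict : valuation R E :=
  Valuation restr_eqy (fun x => valf_neqNy w (j x)) restrM restrD.

End RestrictValuation.

Definition padic_val (R : realType) (p : nat) (q : rat) : \bar R :=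
  if q == 0 then +oo%E
  else ((logn p `|numq q|%N)%:R - (logn p `|denq q|%N)%:R)%:E.

(* The field of p-adic numbers, up to isomorphism, as the completion of the
   rationals for the p-adic valuation. *)
Definition is_Qp (R : realType) (p : nat) (F : fieldType) : Prop :=
  exists (u : valuation R F) (h : {rmorphism rat -> F}),
    [/\ forall q, u (h q) = padic_val R p q,
        complete u &
        forall (x : F) (B : R), exists q : rat, (B%:E < u (x - h q)%R)%E].

Definition finite_ext_Qp (R : realType) (p : nat) (K : fieldType) : Prop :=
  exists (Qp : fieldType) (e : {rmorphism Qp -> K}),
    is_Qp R p Qp /\
    exists (d : nat) (b : 'I_d -> K), forall x : K,
      exists t : 'I_d -> Qp, x = \sum_i e (t i) * b i.

Section Inertia.
Context {R : realType} {K : fieldType} {L : splittingFieldType K}.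
Variable w : valuation R L.

(* The automorphisms inducing the identity on the residue field of [w]. *)
Definition inertia_set : {set gal_of {:L}} :=
  [set s in 'Gal({:L} / 1)%g |
    `[< forall x : L, (0 <= w x)%E -> (0 < w (s x - x)%R)%E >]].

Lemma inertia_group_set : group_set inertia_set.
Proof.
apply/group_setP; split=> [|s t].
  rewrite inE group1; apply/asboolP => x _.
  by rewrite gal_id subrr valf0 ltry.
rewrite !inE => /andP[sG /asboolP sI] /andP[tG /asboolP tI].
rewrite groupM //=; apply/asboolP => x x0.
rewrite galM ?memvf //.
have sx0 : (0 <= w (s x))%E.
  rewrite -[s x](subrK x); apply: le_trans (valfD _ _ _).
  by rewrite le_min x0 ltW ?sI.
rewrite -[t (s x) - x](subrKA (s x)).
by apply: lt_le_trans (valfD _ _ _); rewrite lt_min tI // sI.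
Qed.

Canonical inertia_group := Group inertia_group_set.

End Inertia.

Section Dynamics.
Context {F : fieldType}.

Definition unicrit (l : nat) (c : F) : {poly F} := 'X^l - c%:P.

(* The n-th iterate of the unicritical polynomial, as a polynomial. *)
Definition fiter (l : nat) (c : F) (n : nat) : {poly F} :=
  iter n (fun g => unicrit l c \Po g) 'X.

End Dynamics.

Definition nu_infty (R : realType) (F : fieldType) (v : valuation R F)
    (l : nat) : \bar R :=
  ((- (l%:R / (l%:R - 1)))%:E * v l%:R)%E.

(* Main.v *)
Require Import Defs.
From HB Require Import structures.
From mathcomp Require Import all_boot all_order all_fingroup all_algebra all_solvable all_field.
From mathcomp Require Import boolp classical_sets cardinality reals constructive_ereal.
From mathcomp Require Import ring lra.

Set Implicit Arguments.
Unset Strict Implicit.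
Unset Printing Implicit Defensive.
Import Order.TTheory GRing.Theory Num.Theory.
Local Open Scope ring_scope.

(** Let [f x = x ^+ l - c], let [g] be the valuation of [c], and let [e] be the
    common valuation of the differences [1 - zeta], for [zeta] an [l]-th root of
    unity other than 1; thus [e = v l / (l - 1)] and [nu_infty = - (l * e)].

    All points of the fibers [f^-m(a)] with [m >= 1] have valuation
    [rho = g / l], and any two of them, [x] and [y], satisfy
    [rho + e < w (x - zeta * y)] for some root of unity [zeta]
    ([fiber_close]).  This is proved by induction on [m]: if [f x] and [f y] are
    so related, then [x ^+ l - y ^+ l = f x - f y] has valuation at least
    [rho + e], and the hypothesis [g < - (l * e)] says exactly that this exceeds
    [l * (rho + e)]; as [x ^+ l - y ^+ l] is the product of the [l] factors
    [x - zeta * y], one of these has valuation larger than [rho + e].  Since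
    distinct roots of unity multiply [y] to points at valuation [rho + e]
    from each other, [zeta] is unique.

    The base field being complete, the valuation has only one extension to a
    finite extension ([extension_unique]), so the Galois group preserves it.
    - An automorphism that fixes one point [x] of the fiber fixes every other
      point [y] ([fiber_rigid]): it preserves the closeness of [y] to
      [zeta * x], so it moves [y] by less than a nontrivial root of unity
      would, whereas by induction on the level it fixes [f y].  By Galois
      theory a single point generates the whole field ([adjoin_fiber]).
    - Fix [alpha] in the fiber, with iterates [alpha_1, ..., alpha_n = alpha],
      where [alpha_i] has level [i].  Sending [s] to the roots of unity closest
      to the quotients [s alpha_i / alpha_i] is a homomorphism to the [n]-th
      power of the group of roots of unity, and it is injective
      ([gal_embeds]).
    - The quotient by inertia acts faithfully on the residue field of the
      extension.  This field is finite when the residue field of the base is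
      ([finite_residue_ext]), so the quotient is cyclic
      ([cyclic_mod_inertia]); its order then equals its exponent, which
      divides [l]. *)

(** * Valuations *)

Section ValuationBasics.
Context {R : realType} {F : fieldType} (v : valuation R F).
Implicit Types (x y : F) (r t : R).

Lemma valf_fin x : x != 0 -> exists r, v x = r%:E.
Proof.
move=> /eqP x0; have := valf_neqNy v x.
have : v x <> +oo%E by move=> /valf_eqy.
by case: (v x) => [r| |] // _ _; exists r.
Qed.

Lemma valf_lower x : exists r, (r%:E <= v x)%E.
Proof.
have [->|/valf_fin[r ->]] := eqVneq x 0; last by exists r.
by exists 0; rewrite valf0 leey.
Qed.

Lemma valfD_ge t x y :
  (t%:E <= v x)%E -> (t%:E <= v y)%E -> (t%:E <= v (x + y)%R)%E.
Proof. by move=> tx ty; apply: le_trans (valfD v _ _); rewrite le_min tx. Qed.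

Lemma valfD_gt t x y :
  (t%:E < v x)%E -> (t%:E < v y)%E -> (t%:E < v (x + y)%R)%E.
Proof.
by move=> tx ty; apply: lt_le_trans (valfD v _ _); rewrite lt_min tx.
Qed.

Lemma valf_sum_ge I (s : seq I) (P : pred I) (E : I -> F) t :
  (forall i, P i -> (t%:E <= v (E i))%E) ->
  (t%:E <= v (\sum_(i <- s | P i) E i)%R)%E.
Proof.
by move=> tE; elim/big_ind: _ => //; [rewrite valf0 leey|exact: valfD_ge].
Qed.

Lemma valfBC x y : v (x - y) = v (y - x).
Proof. by rewrite -opprB valfN. Qed.

Lemma valfM_ge r t x y :
  (r%:E <= v x)%E -> (t%:E <= v y)%E -> ((r + t)%:E <= v (x * y)%R)%E.
Proof. by move=> rx ty; rewrite valfM EFinD leeD. Qed.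

Lemma valfM_fin r t x y :
  v x = r%:E -> v y = t%:E -> v (x * y) = (r + t)%:E.
Proof. by move=> rx ty; rewrite valfM rx ty. Qed.

Lemma valfV r x : v x = r%:E -> v x^-1 = (- r)%:E.
Proof.
move=> vx; have x0 : x != 0.
  by apply: contra_eq_neq vx => ->; rewrite valf0.
have := valfM v x x^-1; rewrite mulfV // valf1 vx.
case: (v x^-1) => [s| |] //= [] /eqP.
by rewrite eq_sym addrC addr_eq0 => /eqP ->.
Qed.

Lemma valfX r x n : v x = r%:E -> v (x ^+ n) = (n%:R * r)%:E.
Proof.
move=> vx; elim: n => [|n IHn]; first by rewrite expr0 valf1 mul0r.
rewrite exprS (valfM_fin vx IHn); congr (_%:E).
by rewrite [in RHS]mulrSr mulrDl mul1r addrC.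
Qed.

Lemma valf_nat n : (0 <= v n%:R)%E.
Proof.
elim: n => [|n IHn]; first by rewrite valf0 leey.
by rewrite mulrSr; apply: valfD_ge; rewrite ?valf1.
Qed.

(** The ultrametric inequality is an equality when one term dominates. *)
Lemma valfD_dom r x y : v x = r%:E -> (r%:E < v y)%E -> v (x + y) = r%:E.
Proof.
move=> vx ry; apply/eqP; rewrite eq_le; apply/andP; split; last first.
  by apply: valfD_ge; rewrite ?vx // ltW.
rewrite leNgt; apply/negP => rxy.
suff : (r%:E < v x)%E by rewrite vx ltxx.
by rewrite -(addrK y x); apply: valfB_gt.
Qed.

Lemma valf_unity n z : (0 < n)%N -> z ^+ n = 1 -> v z = 0%E.
Proof.
move=> n0 zn; have z0 : z != 0.
  apply: contra_eq_neq zn => ->; rewrite expr0n gtn_eqF //.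
  by rewrite eq_sym oner_eq0.
have [r vz] := valf_fin z0; have := valfX n vz.
rewrite zn valf1 vz => -[] /esym/eqP; rewrite mulf_eq0 pnatr_eq0 gtn_eqF //=.
by move/eqP->.
Qed.

End ValuationBasics.

(** * Uniqueness of the extension of a complete valuation *)

Section Uniqueness.
Context {R : realType} {K : fieldType} (v : valuation R K).
Hypothesis v_complete : complete v.
Context {L : fieldExtType K}.

Lemma extends_scale (u : valuation R L) (u_ext : forall x, u x%:A = v x) t x :
  u (t *: x) = (v t + u x)%E.
Proof. by rewrite -mulr_algl valfM u_ext. Qed.

Lemma nat_above (x : R) : exists n : nat, x <= n%:R.
Proof.
exists (Num.bound `|x|); apply/ltW/(le_lt_trans (ler_norm x)).
exact: archi_boundP (normr_ge0 x).
Qed.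

(** Affine subspaces that avoid 0 stay at a bounded distance from 0, because
    vectors of the form [b0] plus a combination of [b] that tend to 0 have
    Cauchy coordinates, hence a limit of the same form, which is 0. *)
Lemma affine_bound (u : valuation R L) (u_ext : forall x, u x%:A = v x)
    d (b : 'I_d -> L) (b0 : L) (C : R)
    (b_bound : forall (t : 'I_d -> K) (i : 'I_d) (B : R),
      ((B + C)%:E <= u (\sum_k t k *: b k)%R)%E -> (B%:E <= v (t i))%E)
    (b0_off : forall t : 'I_d -> K, b0 + \sum_k t k *: b k != 0) :
  exists D : R, forall t : 'I_d -> K, (u (b0 + \sum_k t k *: b k)%R < D%:E)%E.
Proof.
apply: contrapT => noD.
have /choice[T T_small] : forall m : nat, exists t : 'I_d -> K,
    (m%:R%:E <= u (b0 + \sum_k t k *: b k)%R)%E.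
  move=> m; apply: contrapT => nt; apply: noD; exists m%:R => t.
  by rewrite ltNge; apply/negP => mt; apply: nt; exists t.
have T_diff m m' : \sum_k (T m k - T m' k) *: b k =
    (b0 + \sum_k T m k *: b k) - (b0 + \sum_k T m' k *: b k).
  rewrite opprD addrACA subrr add0r -sumrB.
  by apply: eq_bigr => k _; rewrite scalerBl.
have /choice[s s_lim] : forall k : 'I_d, exists x : K, forall B : R,
    exists N, forall m, (N <= m)%N -> (B%:E < v (T m k - x)%R)%E.
  move=> k; apply: v_complete => B; have [N BN] := nat_above (B + 1 + C).
  exists N => m m' Nm Nm'; apply: (@lt_le_trans _ _ (B + 1)%:E).
    by rewrite lte_fin ltrDl.
  apply: (b_bound (fun k => T m k - T m' k)).
  rewrite T_diff; apply: (@le_trans _ _ N%:R%:E); first by rewrite lee_fin.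
  by apply: valfB_ge; apply: le_trans (T_small _); rewrite lee_fin ler_nat.
have /negP := b0_off s; apply; apply/eqP/(valf_eqy u).
have big_val B : (B%:E <= u (b0 + \sum_k s k *: b k)%R)%E.
  have /choice[N N_lim] : forall k : 'I_d, exists N, forall m, (N <= m)%N ->
      (B%:E <= u ((T m k - s k) *: b k)%R)%E.
    move=> k; have [r rb] := valf_lower u (b k).
    have [N N_lim] := s_lim k (B - r); exists N => m /N_lim /ltW Bm.
    by rewrite (extends_scale u_ext) -(subrK r B) EFinD leeD.
  have [M BM] := nat_above B.
  pose m := maxn M (\max_k N k)%N.
  have -> : b0 + \sum_k s k *: b k =
      (b0 + \sum_k T m k *: b k) - \sum_k (T m k - s k) *: b k.
    rewrite -addrA -sumrB; congr (_ + _); apply: eq_bigr => k _.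
    by rewrite scalerBl subKr.
  apply: valfB_ge.
    apply: le_trans (T_small _); rewrite lee_fin (le_trans BM) // ler_nat.
    exact: leq_maxl.
  apply: valf_sum_ge => k _; apply: N_lim.
  by rewrite (leq_trans _ (leq_maxr _ _)) // leq_bigmax.
move: (valf_neqNy u (b0 + \sum_k s k *: b k)) big_val.
case: (u _) => [r| |] // _ /(_ (r + 1)); rewrite lee_fin => ?; exfalso; lra.
Qed.

(** Coordinates with respect to independent vectors are bounded linear forms;
    this is where completeness of the base field enters. *)
Lemma coord_bound (u : valuation R L) (u_ext : forall x, u x%:A = v x)
    d (b : 'I_d -> L)
    (b_free : forall t : 'I_d -> K,
       \sum_k t k *: b k = 0 -> forall i, t i = 0) :
  exists C : R, forall (t : 'I_d -> K) (i : 'I_d) (B : R),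
    ((B + C)%:E <= u (\sum_k t k *: b k)%R)%E -> (B%:E <= v (t i))%E.
Proof.
elim: d b b_free => [|d IHd] b b_free; first by exists 0 => t [].
pose b' k := b (lift ord0 k); pose b0 := b ord0.
have sumE (t : 'I_d.+1 -> K) : \sum_k t k *: b k =
    t ord0 *: b0 + \sum_k t (lift ord0 k) *: b' k by rewrite big_ord_recl.
pose ext (x : K) (t : 'I_d -> K) k := oapp t x (unlift ord0 k).
have extE x t : \sum_k ext x t k *: b k = x *: b0 + \sum_k t k *: b' k.
  rewrite sumE /ext unlift_none /=; congr (_ + _).
  by apply: eq_bigr => k _; rewrite liftK.
have [t b't0 i|C C_bound] := IHd b'.
  have := b_free (ext 0 t); rewrite extE scale0r add0r => /(_ b't0).
  by move=> /(_ (lift ord0 i)); rewrite /ext liftK.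
have [t|D D_bound] := affine_bound (b0 := b0) u_ext C_bound.
  apply/eqP => b0t; have := b_free (ext 1 t).
  rewrite extE scale1r => /(_ b0t ord0); rewrite /ext unlift_none /=.
  by move/eqP; rewrite oner_eq0.
have [c cb0] := valf_lower u b0.
have head_bound t B : ((B + D)%:E <= u (\sum_k t k *: b k)%R)%E ->
    (B%:E <= v (t ord0))%E.
  have [->|t0] := eqVneq (t ord0) 0; first by rewrite valf0 leey.
  have -> : \sum_k t k *: b k = t ord0 *:
      (b0 + \sum_k ((t ord0)^-1 * t (lift ord0 k)) *: b' k).
    rewrite sumE scalerDr scaler_sumr; congr (_ + _); apply: eq_bigr => k _.
    by rewrite scalerA mulVKf.
  rewrite (extends_scale u_ext); have [r ->] := valf_fin v t0.
  have := D_bound (fun k => (t ord0)^-1 * t (lift ord0 k)).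
  case: (u _) => [s| |] //; rewrite -EFinD !lee_fin lte_fin; lra.
exists (`|D| + `|C| + `|c|) => t i B BC.
have weaken x : x <= B + (`|D| + `|C| + `|c|) ->
    (x%:E <= u (\sum_k t k *: b k)%R)%E.
  by move=> xB; apply: le_trans BC; rewrite lee_fin.
have [normD normC normc] := And3 (ler_norm D) (ler_norm C) (ler_norm (- c)).
rewrite normrN in normc.
have [posD posC posc] := And3 (normr_ge0 D) (normr_ge0 C) (normr_ge0 c).
case: (unliftP ord0 i) => [k|] -> {i}; last first.
  by apply: head_bound; apply: weaken; lra.
apply: (C_bound (fun k => t (lift ord0 k))).
have -> : \sum_k t (lift ord0 k) *: b' k =
    \sum_k t k *: b k - t ord0 *: b0 by rewrite sumE addrC addKr.
apply: valfB_ge; first by apply: weaken; lra.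
rewrite (extends_scale u_ext) -(subrK c (B + C)) EFinD leeD //.
by apply: head_bound; apply: weaken; lra.
Qed.

Lemma extension_le (u1 u2 : valuation R L)
    (u1_ext : forall x, u1 x%:A = v x) (u2_ext : forall x, u2 x%:A = v x) x :
  (u1 x <= u2 x)%E.
Proof.
pose X := vbasis {:L}; pose d := \dim {:L}.
have [C C_bound] : exists C : R, forall y B,
    ((B + C)%:E <= u1 y)%E -> (B%:E <= u2 y)%E.
  have X_free : forall t : 'I_d -> K,
      \sum_k t k *: X`_k = 0 -> forall i, t i = 0.
    by have /freeP := basis_free (vbasisP {:L}).
  have [C C_bound] := coord_bound u1_ext X_free.
  have /choice[c cX] := fun k : 'I_d => valf_lower u2 X`_k.
  exists (C + \sum_k `|c k|) => y B.
  rewrite (coord_basis (vbasisP _) (memvf y)).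
  move=> By; apply: valf_sum_ge => k _; rewrite (extends_scale u2_ext).
  have ck : B <= (B + \sum_k `|c k|) + c k.
    rewrite -addrA lerDl (bigD1 k) //= addrAC.
    by rewrite addr_ge0 ?sumr_ge0 // -lerBlDr sub0r -normrN ler_norm.
  apply: (@le_trans _ _ ((B + \sum_k `|c k|) + c k)%:E).
    by rewrite lee_fin.
  rewrite EFinD leeD //; apply: (C_bound (fun k => coord X k y)).
  by apply: le_trans By; rewrite lee_fin; lra.
have [->|x0] := eqVneq x 0; first by rewrite !valf0.
have [r1 ux1] := valf_fin u1 x0; have [r2 ux2] := valf_fin u2 x0.
rewrite ux1 ux2 lee_fin leNgt; apply/negP => r21.
(* Powers of [x] amplify the gap between both values past the constant [C]. *)
have [n Cn] := nat_above ((C + 1) / (r1 - r2)).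
have := C_bound (x ^+ n) (n%:R * r1 - C).
rewrite (valfX n ux1) (valfX n ux2) subrK lexx lee_fin => /(_ isT).
move: Cn; rewrite ler_pdivrMr ?subr_gt0 // mulrBr; lra.
Qed.

(** This is why automorphisms over the base field preserve the valuation:
    composing it with one of them gives another extension. *)
Lemma extension_unique (u1 u2 : valuation R L)
    (u1_ext : forall x, u1 x%:A = v x) (u2_ext : forall x, u2 x%:A = v x) :
  u1 =1 u2.
Proof. by move=> x; apply/eqP; rewrite eq_le !extension_le. Qed.

End Uniqueness.

(** * Valuations and roots of unity *)

Section RootsOfUnity.
Context {R : realType} {F : fieldType} (w : valuation R F).
Variables (l : nat) (z : F).
Hypotheses (l_gt1 : (1 < l)%N) (z_prim : l.-primitive_root z).

Lemma prod_one_sub_unity : \prod_(1 <= i < l) (1 - z ^+ i) = l%:R.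
Proof.
have := factor_Xn_sub_1 z_prim.
rewrite big_ltn ?(ltnW l_gt1) // expr0 subrX1 => /mulfI-/(_ _) H.
have X1 : 'X - 1%:P != 0 :> {poly F} by rewrite polyXsubC_eq0.
have /(congr1 (fun q : {poly F} => q.[1])) := H X1.
rewrite horner_prod horner_sum.
under eq_bigr do rewrite !hornerE.
under [in RHS]eq_bigr do rewrite !hornerE expr1n.
by rewrite sumr_const card_ord.
Qed.

Lemma subXX_unity_prod (x y : F) : y != 0 ->
  x ^+ l - y ^+ l = \prod_(0 <= i < l) (x - z ^+ i * y).
Proof.
move=> y0; have /(congr1 (fun q : {poly F} => q.[x / y])) :=
  factor_Xn_sub_1 z_prim.
rewrite horner_prod !hornerE => H.
have -> : x ^+ l - y ^+ l = y ^+ l * ((x / y) ^+ l - 1).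
  by rewrite mulrBr mulr1 expr_div_n mulrC divfK ?expf_neq0.
rewrite -H -[X in y ^+ X]subn0 -prodr_const_nat -big_split /=.
by apply: eq_bigr => i _; rewrite !hornerE; field.
Qed.

Lemma valf_prod (E : nat -> F) (r : nat -> R) m n :
  (forall i, (m <= i < n)%N -> w (E i) = (r i)%:E) ->
  w (\prod_(m <= i < n) E i) = (\sum_(m <= i < n) r i)%:E.
Proof.
move=> wE; rewrite big_nat [in RHS]big_nat.
elim/big_rec2: _ => [|i s x mn IH]; first exact: valf1.
by rewrite (valfM_fin (wE i mn) IH).
Qed.

Lemma valf_prod_le (E : nat -> F) (t : R) n :
  (forall i, (i < n)%N -> (w (E i) <= t%:E)%E) ->
  (w (\prod_(0 <= i < n) E i)%R <= (n%:R * t)%:E)%E.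
Proof.
elim: n => [|n IHn] wE; first by rewrite big_geq // valf1 mul0r.
rewrite big_nat_recr //= valfM mulrSr mulrDl mul1r EFinD.
apply: leeD; last exact: wE.
by apply: IHn => i /ltnW-/wE.
Qed.

Lemma prim_root_pow (x : F) : x ^+ l = 1 -> exists2 i, (i < l)%N & x = z ^+ i.
Proof. by move=> /(prim_rootP z_prim)[i ->]; exists i. Qed.

Lemma unity_val x : x ^+ l = 1 -> w x = 0%E.
Proof. exact: valf_unity (ltnW l_gt1). Qed.

(** The product of the [l - 1] differences is [l].  If [l] has valuation 0, so
    has each of these integral factors; if [l] is prime, the factors divide one
    another, as each [z ^+ i] is a power of each other one. *)
Lemma valf_one_sub_unity (lv : R) : w l%:R = lv%:E -> lv = 0 \/ prime l ->
  forall i, (0 < i < l)%N -> w (1 - z ^+ i) = (lv / (l%:R - 1))%:E.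
Proof.
move=> wl tame_wild.
pose r i := fine (w (1 - z ^+ i)).
have rE i : (0 < i < l)%N -> w (1 - z ^+ i) = (r i)%:E.
  move=> /andP[i0 il]; have [|s] := @valf_fin _ _ w (1 - z ^+ i).
    rewrite subr_eq0 eq_sym -(prim_order_dvd z_prim).
    by apply/negP => /(dvdn_leq i0); rewrite leqNgt il.
  by rewrite /r => ->.
have r_ge0 i : (0 < i < l)%N -> 0 <= r i.
  move=> il; rewrite -lee_fin -rE //; apply: valfB_ge; rewrite ?valf1 //.
  by rewrite (unity_val _) // exprAC (prim_expr_order z_prim) expr1n.
have sum_r : \sum_(1 <= i < l) r i = lv.
  have := valf_prod rE; rewrite prod_one_sub_unity wl.
  by case.
move=> i il; rewrite rE //; congr (_%:E).
case: tame_wild => [lv0|l_prime].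
  rewrite lv0 mul0r; apply/eqP; move: sum_r; rewrite lv0 => /eqP.
  rewrite big_nat psumr_eq0 // => /allP/(_ i).
  by rewrite mem_index_iota => /(_ il)/implyP/(_ il).
have r_le j k : (0 < j < l)%N -> (0 < k < l)%N -> r j <= r k.
  move=> jl kl; have : l.-primitive_root (z ^+ j).
    rewrite prim_root_exp_coprime // coprime_sym prime_coprime //.
    by case/andP: jl => j0 jl; apply/negP => /(dvdn_leq j0); rewrite leqNgt jl.
  have zk1 : (z ^+ k) ^+ l = 1.
    by rewrite exprAC (prim_expr_order z_prim) expr1n.
  move=> /prim_rootP/(_ _ zk1)[m zk].
  rewrite -lee_fin -!rE // zk -[X in (_ <= w X)%E]opprB subrX1 -mulNr opprB.
  rewrite valfM leeDl // -[0%E]/(0%:E); apply: valf_sum_ge => h _.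
  rewrite unity_val // exprAC [z ^+ j ^+ l]exprAC.
  by rewrite (prim_expr_order z_prim) !expr1n.
have : \sum_(1 <= k < l) r k = \sum_(1 <= k < l) r i.
  rewrite big_nat [RHS]big_nat; apply: eq_bigr => k kl.
  by apply/eqP; rewrite eq_le !r_le.
rewrite sum_r sumr_const_nat => ->.
have l1 : l%:R - 1 = (l - 1)%:R :> R by rewrite natrB // ltnW.
rewrite l1 -[r i *+ _]mulr_natr mulfK // pnatr_eq0 subn_eq0 -ltnNge //.
Qed.

Variable e : R.
Hypothesis e_gap : forall i, (0 < i < l)%N -> w (1 - z ^+ i) = e%:E.

Lemma unity_gap x : x ^+ l = 1 -> x != 1 -> w (x - 1) = e%:E.
Proof.
move=> /prim_root_pow[i il ->] zi; rewrite valfBC; apply: e_gap.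
by rewrite il andbT lt0n; apply: contraNneq zi => ->; rewrite expr0.
Qed.

(** The value [e] separates roots of unity: this turns estimates into
    equalities. *)
Lemma unity_gap_eq r x y a : w a = r%:E -> x ^+ l = 1 -> y ^+ l = 1 ->
  ((r + e)%:E < w (x * a - y * a)%R)%E -> x = y.
Proof.
move=> wa xl yl; have y0 : y != 0.
  apply: contra_eq_neq yl => ->; rewrite expr0n gtn_eqF ?(ltnW l_gt1) //.
  by rewrite eq_sym oner_eq0.
apply: contraTeq => xy; rewrite -leNgt -mulrBl.
have -> : x - y = (x / y - 1) * y by rewrite mulrBl mul1r divfK.
have u1 : x / y != 1 by rewrite -(inj_eq (mulIf y0)) divfK // mul1r.
have wu := unity_gap _ u1.
rewrite !valfM wu ?expr_div_n ?xl ?yl ?divr1 // (unity_val yl) wa adde0 -EFinD.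
by rewrite addrC.
Qed.

(** Pigeonhole on the factorization of [x ^+ l - y ^+ l]: if the product is
    small, so is one of the factors. *)
Lemma close_root r x y : w y = r%:E ->
  ((l%:R * (r + e))%:E < w (x ^+ l - y ^+ l)%R)%E ->
  exists2 i, (i < l)%N & ((r + e)%:E < w (x - z ^+ i * y)%R)%E.
Proof.
move=> wy; have y0 : y != 0 by apply: contra_eq_neq wy => ->; rewrite valf0.
rewrite subXX_unity_prod // => lxy; apply: contrapT => far.
have : (w (\prod_(0 <= i < l) (x - z ^+ i * y))%R <= (l%:R * (r + e))%:E)%E.
  apply: valf_prod_le => i il; rewrite leNgt; apply/negP => near.
  by apply: far; exists i.
by rewrite leNgt lxy.
Qed.

End RootsOfUnity.

(** * Fibers of the iterates *)

Section Fibers.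
Context {R : realType} {F : fieldType} (w : valuation R F).
Variables (l : nat) (z : F).
Hypotheses (l_gt1 : (1 < l)%N) (z_prim : l.-primitive_root z).
Variable e : R.
Hypotheses (e_ge0 : 0 <= e)
  (e_gap : forall i, (0 < i < l)%N -> w (1 - z ^+ i) = e%:E).
Variables (c a : F) (g : R).
Hypotheses (wc : w c = g%:E) (g_lt : g < - (l%:R * e)) (wa : (g%:E < w a)%E).

Let f (x : F) := x ^+ l - c.
Let rho := g / l%:R.

Let l_gt0 : 0 < l%:R :> R. Proof. by rewrite ltr0n ltnW. Qed.

Let g_lt_rho : g < rho.
Proof.
have g0 : g < 0.
  by apply: lt_le_trans g_lt _; rewrite oppr_le0 mulr_ge0 ?(ltW l_gt0).
by rewrite ltr_pdivlMr // gtr_nMr // ltr1n.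
Qed.

(** The term [c] dominates in [x ^+ l = f x + c].  As [rho] is itself larger
    than [g], the same applies again to the preimages of [x]. *)
Lemma valf_preimage x : (g%:E < w (f x))%E -> w x = rho%:E.
Proof.
move=> wf.
have wxl : w (x ^+ l) = g%:E.
  by rewrite -(subrK c (x ^+ l)) addrC; apply: valfD_dom wc wf.
have x0 : x != 0.
  apply: contra_eq_neq wxl => ->.
  by rewrite expr0n gtn_eqF ?(ltnW l_gt1) ?valf0.
have [s ws] := valf_fin w x0; move: wxl; rewrite (valfX l ws) ws /rho => -[] <-.
by rewrite mulrC mulKf // gt_eqF.
Qed.

Lemma valf_orbit m x : iter m f x = a -> (g%:E < w x)%E.
Proof.
elim: m x => [|m IHm] x; first by move=> /= ->.
by rewrite iterSr => /IHm/valf_preimage ->; rewrite lte_fin.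
Qed.

Lemma valf_fiber m x : iter m.+1 f x = a -> w x = rho%:E.
Proof. by rewrite iterSr => /valf_orbit/valf_preimage. Qed.

(** The heart of the argument: if the images [f x] and [f y] are close up to a
    root of unity, then their difference [x ^+ l - y ^+ l] has valuation at
    least [rho + e], which exceeds [g + l * e = l * (rho + e)] exactly because
    [g < - (l * e)]; hence [close_root] applies to [x] and [y]. *)
Lemma fiber_close m x y : iter m.+1 f x = a -> iter m.+1 f y = a ->
  exists2 i, (i < l)%N & ((rho + e)%:E < w (x - z ^+ i * y)%R)%E.
Proof.
elim: m x y => [|m IHm] x y fx fy; apply: close_root (valf_fiber fy) _ => //.
  have -> : x ^+ l = y ^+ l by apply: (addIr (- c)); rewrite [LHS]fx [RHS]fy.
  by rewrite subrr valf0 ltry.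
have -> : x ^+ l - y ^+ l = f x - f y by rewrite opprB addrA subrK.
move: fx fy; rewrite iterSr [in iter _.+2 f y]iterSr => fx fy.
have [i il xy] := IHm _ _ fx fy.
have -> : f x - f y = (f x - z ^+ i * f y) + (z ^+ i - 1) * f y.
  by rewrite mulrBl mul1r addrA subrK.
apply: (@lt_le_trans _ _ (rho + e)%:E).
  have rhoE : l%:R * rho = g by rewrite /rho mulrC divfK // gt_eqF.
  rewrite lte_fin mulrDr rhoE.
  (* Clearing the denominator, this is [(l - 1) * (g + l * e) < 0]. *)
  have l1 : 0 < l%:R - 1 :> R by rewrite subr_gt0 ltr1n.
  have gle : 0 < - g - l%:R * e by rewrite subr_gt0 ltrNr.
  have : 0 < (l%:R - 1) * (- g - l%:R * e) by rewrite mulr_gt0.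
  rewrite -(ltr_pM2l l_gt0) [l%:R * (rho + e)]mulrDr rhoE; nra.
apply: valfD_ge; first exact: ltW.
have [->|zi] := eqVneq (z ^+ i) 1; first by rewrite subrr mul0r valf0 leey.
rewrite valfM (unity_gap z_prim e_gap) //.
  by rewrite (valf_fiber fy) -EFinD lee_fin addrC.
by rewrite exprAC (prim_expr_order z_prim) expr1n.
Qed.

Section Automorphism.
Variable s : {rmorphism F -> F}.
Hypotheses (s_isom : forall x, w (s x) = w x) (sz : s z = z) (sc : s c = c)
  (sa : s a = a).

(** If [s] fixes [f x] then [s x / x] is a root of unity, and it is 1 as soon as
    [s x] is close to [x]. *)
Lemma fixed_of_close x : w x = rho%:E -> s (f x) = f x ->
  ((rho + e)%:E < w (s x - x)%R)%E -> s x = x.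
Proof.
move=> wx sfx; have x0 : x != 0 by apply: contra_eq_neq wx => ->; rewrite valf0.
have sxl : (s x / x) ^+ l = 1.
  move: sfx; rewrite rmorphB sc rmorphXn => /(addIr (- c)) sxl.
  by rewrite expr_div_n sxl divff ?expf_neq0.
have -> : s x = (s x / x) * x by rewrite divfK.
rewrite -[X in _ - X]mul1r.
move=> /(unity_gap_eq l_gt1 z_prim e_gap wx sxl (expr1n _ _)) ->.
by rewrite mul1r.
Qed.

(** An analogue of Krasner's lemma, by induction on the level: [y] is closer to
    the fixed point [z ^+ i * x] than to the other multiples of [y] by roots of
    unity, among which [s y] lies. *)
Lemma fiber_rigid m x y : iter m f x = a -> iter m f y = a ->
  s x = x -> s y = y.
Proof.
elim: m x y => [|m IHm] x y; first by move=> /= _ ->.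
move=> fx fy sx; have [i _ xy] := fiber_close fy fx.
apply: fixed_of_close (valf_fiber fy) _ _.
  apply: (IHm (f x)); rewrite -?iterSr //.
  by rewrite rmorphB sc rmorphXn sx.
rewrite -(subrKA (z ^+ i * x)); apply: valfD_gt; last by rewrite valfBC.
by have := xy; rewrite -s_isom rmorphB rmorphM rmorphXn sz sx.
Qed.

End Automorphism.
End Fibers.

(** * Group actions on finite fields *)

Section FiniteFields.

(** The classical description of the automorphisms of a finite field, via its
    structure of Galois extension of the prime field. *)
Lemma finField_aut_pow (F : finFieldType) p (pF : p \in [pchar F])
    (s : {rmorphism F -> F}) :
  exists j, forall x, s x = x ^+ (p ^ j).
Proof.
pose L : splittingFieldType 'F_p := pPrimeCharType pF.
pose f : L -> L := s.
have fD : zmod_morphism f by move=> x y; exact: (rmorphB s).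
have fM : monoid_morphism f.
  by split; [exact: (rmorph1 s) | move=> x y; exact: (rmorphM s)].
have fZ : scalable f.
  by move=> i x; rewrite /f [i *: _]mulr_natl (rmorphMn s) -mulr_natl.
pose faM := GRing.isZmodMorphism.Build _ _ f fD.
pose fmM := GRing.isMonoidMorphism.Build _ _ f fM.
pose flM := GRing.isScalable.Build _ _ _ _ f fZ.
pose fLRM : {lrmorphism L -> L} := HB.pack f faM fmM flM.
have /kAut_to_gal[b galb fE]: kAut 1 {:L} (linfun fLRM).
  rewrite kAutfE; apply/kHomP_tmp; split=> [_ /vlineP[k ->] | x y _ _].
    by rewrite lfunE linearZ /=; congr (_ *: _); exact: (rmorph1 s).
  by rewrite !lfunE; exact: (rmorphM fLRM).
have [alpha] := finField_galois_generator (sub1v {:L}).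
rewrite dimv1 card_Fp ?(pcharf_prime pF) // expn1 => /eqP gen alphaE.
move: galb; rewrite gen => /cycleP[j bj]; exists j => x.
transitivity ((b : L -> L) (x : L)).
  by rewrite -(fE (x : L)) ?memvf // lfunE.
rewrite {}bj; elim: j => [|j IHj]; first by rewrite expg0 gal_id.
by rewrite expgSr galM ?memvf // IHj alphaE ?memvf // -exprM -expnSr.
Qed.

(** The image of the action lies in the cyclic group of permutations generated
    by the Frobenius automorphism. *)
Lemma cyclic_finField_action (gT : finGroupType) (G N : {group gT})
    (F : finFieldType) (act : gT -> {rmorphism F -> F}) :
  (forall s t x, act (s * t)%g x = act t (act s x)) ->
  (forall s, s \in N = (s \in G) && [forall x, act s x == x]) ->
  cyclic (G / N)%g.
Proof.
move=> actM N_ker.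
pose phi s : {perm F} := perm (@fmorph_inj _ _ (act s)).
have phiM : {in G &, {morph phi : s t / (s * t)%g >-> (s * t)%g}}.
  by move=> s t _ _; apply/permP => x; rewrite permM !permE actM.
pose Phi := Morphism phiM.
have -> : N = ('ker Phi)%G.
  apply: val_inj; apply/setP => s /=; rewrite N_ker !inE.
  case: (s \in G) => //=; apply/forallP/eqP => [fix_s | /permP phi1 x].
    by apply/permP => x; rewrite permE perm1; apply/eqP.
  by have := phi1 x; rewrite /= permE perm1 => ->.
rewrite (isog_cyclic (first_isog Phi)).
have [p p_prime pF] := finPcharP F.
pose frob : {perm F} := perm (@fmorph_inj _ _ (pFrobenius_aut pF)).
apply: (@cyclicS _ <[frob]>); last exact: cycle_cyclic.
apply/fintype.subsetP => _ /morphimP[s _ _ ->].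
have [j sj] := finField_aut_pow pF (act s).
apply/cycleP; exists j; apply/permP => x; rewrite permE sj permX.
elim: j {sj} => [|j IHj]; first by rewrite expn0 expr1.
by rewrite iterS permE -IHj /= pFrobenius_autE -exprM expnSr.
Qed.

Section FinFieldOf.
Variables (F : fieldType) (e : seq F) (eP : forall x, x \in e).

Let enum_index : pcancel (fun x => index x e) (fun i => Some (nth 0 e i)).
Proof. by move=> x; rewrite nth_index. Qed.

Let enum_axiom : Finite.axiom (undup e).
Proof. by move=> x; rewrite count_uniq_mem ?undup_uniq // mem_undup eP. Qed.

Definition finField_of : finFieldType :=
  let ci := Choice_isCountable.Build F enum_index in
  let fi := isFinite.Build F enum_axiom in
  HB.pack (F : Type) ci fi (GRing.Field.on F).

End FinFieldOf.
End FiniteFields.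

(** * Residue fields *)

Section ResidueField.
Context {R : realType} {L : fieldType} (u : valuation R L).

(** The residue ring as a type of its own, to carry a structure of field. *)
Definition residue_field : Type := residue u.
HB.instance Definition _ := GRing.ComNzRing.on residue_field.

(** Reduction modulo the maximal ideal, extended by 0 to a total function so
    that it can be applied to elements of the field. *)
Definition red (x : L) : residue_field :=
  if insub x is Some y then \pi_({ideal_quot (vmax u)})%qT (y : vring u) else 0.

Lemma redE x (x0 : x \in vring_pred u) :
  red x = \pi_({ideal_quot (vmax u)})%qT (VRing x0).
Proof. by rewrite /red insubT. Qed.

Lemma red_surj (r : residue_field) : exists2 x, (0 <= u x)%E & r = red x.
Proof.
pose y : vring u :=
  generic_quotient.repr (r : {ideal_quot (vmax u)}).
have y0 : vring_val y \in vring_pred u by case: y.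
exists (vring_val y) => //.
rewrite (redE y0) -[LHS](reprK (r : {ideal_quot _})).
by congr (\pi_({ideal_quot (vmax u)})%qT _); apply: val_inj.
Qed.

Lemma redB x y : (0 <= u x)%E -> (0 <= u y)%E -> red (x - y) = red x - red y.
Proof.
move=> x0 y0; have xy0 : x - y \in vring_pred u by apply: valfB_ge.
rewrite (redE x0) (redE y0) (redE xy0) -[RHS]rmorphB.
by congr (\pi_({ideal_quot (vmax u)})%qT _); apply: val_inj.
Qed.

Lemma redM x y : (0 <= u x)%E -> (0 <= u y)%E -> red (x * y) = red x * red y.
Proof.
move=> x0 y0; have xy0 : x * y \in vring_pred u.
  by rewrite /vring_pred unfold_in valfM adde_ge0.
rewrite (redE x0) (redE y0) (redE xy0) -[RHS]rmorphM.
by congr (\pi_({ideal_quot (vmax u)})%qT _); apply: val_inj.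
Qed.

Lemma red1 : red 1 = 1.
Proof.
have u1 : 1 \in vring_pred u by rewrite /vring_pred unfold_in valf1.
rewrite (redE u1) -[RHS](rmorph1 (\pi_({ideal_quot (vmax u)})%qT)).
by congr (\pi_({ideal_quot (vmax u)})%qT _); apply: val_inj.
Qed.

Lemma red_eq0 x : (0 <= u x)%E -> (red x == 0) = (0 < u x)%E.
Proof.
move=> x0; rewrite (redE x0) -[X in (0 < u X)%E]/(vring_val (VRing x0)) -vmaxE.
rewrite -[X in X \in _]subr0 Quotient.idealrBE.
by rewrite [X in _ = (_ == X)]rmorph0.
Qed.

Lemma red_eq x y : (0 <= u x)%E -> (0 <= u y)%E ->
  (red x == red y) = (0 < u (x - y)%R)%E.
Proof.
move=> x0 y0; rewrite -red_eq0 ?redB ?subr_eq0 //; exact: valfB_ge.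
Qed.

Lemma red0 : red 0 = 0.
Proof. by apply/eqP; rewrite red_eq0 valf0 ?ltry ?leey. Qed.

Lemma redD x y : (0 <= u x)%E -> (0 <= u y)%E -> red (x + y) = red x + red y.
Proof.
move=> x0 y0; have Ny0 : (0 <= u (- y)%R)%E by rewrite valfN.
rewrite -[X in _ + X]opprK redB // -[- y]add0r redB ?valf0 ?leey //.
by rewrite red0 sub0r opprK.
Qed.

Lemma red_sum n (E : 'I_n -> L) : (forall i, (0 <= u (E i))%E) ->
  red (\sum_i E i) = \sum_i red (E i).
Proof.
move=> E0; suff [] : red (\sum_i E i) = \sum_i red (E i) /\
    (0 <= u (\sum_i E i)%R)%E by [].
elim/big_rec2: _ => [|i s x _ [<- x0]]; first by rewrite red0 valf0 leey.
by rewrite redD //; split=> //; apply: valfD_ge.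
Qed.

Definition residue_inv (r : residue_field) : residue_field :=
  if r == 0 then 0 else red (s2val (cid2 (red_surj r)))^-1.

Lemma residue_mulVf (r : residue_field) : r != 0 -> residue_inv r * r = 1.
Proof.
move=> r0; rewrite /residue_inv (negPf r0); case: cid2 => x /= x0 rE.
move: r0; rewrite {r}rE red_eq0 // -leNgt => x0'.
have ux : u x = 0%:E by apply/eqP; rewrite eq_le x0 andbC.
have x_neq0 : x != 0 by apply: contra_eq_neq ux => ->; rewrite valf0.
have Vx0 : (0 <= u (x^-1)%R)%E by rewrite (valfV ux) oppr0.
by rewrite -redM // mulVf // red1.
Qed.

Lemma residue_inv0 : residue_inv 0 = 0.
Proof. by rewrite /residue_inv eqxx. Qed.

HB.instance Definition _ :=
  GRing.ComNzRing_isField.Build residue_field residue_mulVf residue_inv0.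

End ResidueField.

Section FiniteResidue.
Context {R : realType} {K : fieldType} (v : valuation R K).
Context {L : fieldExtType K} (u : valuation R L).
Hypothesis u_ext : forall x : K, u x%:A = v x.

Lemma roots_listed (F : fieldType) (q : {poly F}) : q != 0 ->
  exists s : seq F, forall x, root q x -> x \in s.
Proof.
have [n] := ubnP (size q); elim: n q => // n IHn q; rewrite ltnS => qn q0.
have [[x rx]|nr] := pselect (exists x, root q x); last first.
  by exists [::] => x rx; case: nr; exists x.
have /factor_theorem[q' qE] := rx.
have q'0 : q' != 0 by apply: contraNneq q0 => q'0; rewrite qE q'0 mul0r.
have [|s sP] := IHn q' _ q'0.
  by move: qn; rewrite qE size_Mmonic ?monicXsubC // size_XsubC addn2.
exists (x :: s) => y; rewrite qE rootM root_XsubC inE orbC.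
by case/orP=> [->|/sP->] //; rewrite orbT.
Qed.

(** Scaling the minimal polynomial by a coefficient of least valuation makes it
    integral with nonzero reduction. *)
Lemma integral_relation (x : L) : exists (y : 'I_(\dim {:L}).+1 -> K) i0,
  [/\ forall i, (0 <= v (y i))%E, y i0 = 1 & \sum_i (y i)%:A * x ^+ i = 0].
Proof.
set N := (\dim {:L}).+1; pose m := minPoly 1 x.
have m_size : (size m <= N)%N.
  rewrite size_minPoly ltnS; have := dim_Fadjoin 1 x.
  by rewrite dimv1 muln1 => <-; apply/dimvS/subvf.
have /choice[y0 y0E] : forall i : 'I_N, exists y : K, m`_i = y%:A.
  by move=> i; apply/vlineP; have /polyOverP := minPolyOver 1 x; apply.
have rel0 : \sum_i (y0 i)%:A * x ^+ i = 0.
  have /rootP := root_minPoly 1 x; rewrite (horner_coef_wide _ m_size) => mx.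
  by rewrite -[RHS]mx; apply: eq_bigr => i _; rewrite y0E.
have [i1 y1] : exists i1, y0 i1 != 0.
  have lt_deg : ((size m).-1 < N)%N.
    by rewrite (leq_trans _ m_size) // size_minPoly.
  exists (Ordinal lt_deg); have : m`_(size m).-1 = 1.
    by have /monicP := monic_minPoly 1 x.
  have := y0E (Ordinal lt_deg); rewrite /= => -> /eqP.
  by apply: contraTneq => ->; rewrite scale0r eq_sym oner_eq0.
case: (arg_minP (P := xpredT) (i0 := i1) (fun i => v (y0 i)) isT).
move=> i0 _ i0_min.
have y0i0 : y0 i0 != 0.
  apply: contraNneq y1 => yi0; apply/eqP/(valf_eqy v)/eqP.
  by have := i0_min i1 isT; rewrite yi0 valf0 leye_eq.
have [r vr] := valf_fin v y0i0.
exists (fun i => (y0 i0)^-1 * y0 i), i0; split=> [i||].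
- rewrite -[0%E]/(0%:E) -(addNr r).
  by apply: valfM_ge; rewrite ?(valfV vr) // -vr i0_min.
- by rewrite mulVf.
- under eq_bigr do rewrite -scalerA -scalerAl.
  by rewrite -scaler_sumr rel0 scaler0.
Qed.

(** There are finitely many polynomials of bounded degree over a finite residue
    field, and by [integral_relation] every residue of the extension is a root
    of a nonzero one among them, hence of their product. *)
Lemma finite_residue_ext : finite_set [set: residue v] ->
  exists e : seq (residue_field u), forall r, r \in e.
Proof.
move=> /finite_seqP[rs rsE].
have rs_all (r : residue v) : r \in rs.
  by have : [set: residue v]%classic r by []; rewrite rsE.
pose lift (r : residue_field v) := s2val (cid2 (red_surj r)).
pose S := [seq red u (lift r)%:A | r : residue_field v <- rs].
have in_S y : (0 <= v y)%E -> red u y%:A \in S.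
  move=> y0; apply/mapP; exists (red v y); first exact: rs_all.
  apply/eqP; rewrite /lift; case: cid2 => x /= x0 /esym/eqP.
  by rewrite !red_eq ?u_ext // -scalerBl u_ext valfBC.
set N := (\dim {:L}).+1.
pose P (t : {ffun 'I_N -> seq_sub S}) := \sum_i val (t i) *: 'X^i.
have H0 : \prod_(t | P t != 0) P t != 0 by apply/prodf_neq0.
have [e eP] := roots_listed H0; exists e => r; apply: eP.
have [x x0 ->] := red_surj r.
have [y [i0 [y0 y1 rel]]] := integral_relation x.
have uy i : (0 <= u (y i)%:A)%E by rewrite u_ext.
have ux i : (0 <= u (x ^+ i)%R)%E.
  elim: i => [|i IHi]; first by rewrite expr0 valf1.
  by rewrite exprS valfM adde_ge0.
pose t : {ffun 'I_N -> seq_sub S} := [ffun i => SeqSub (in_S _ (y0 i))].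
have PtE : P t = \sum_i red u (y i)%:A *: 'X^i.
  by apply: eq_bigr => i _; rewrite ffunE.
have Pt0 : P t != 0.
  apply/eqP => /(congr1 (fun q : {poly _} => q`_i0)); rewrite PtE coef0.
  rewrite coef_sum (bigD1 i0) //= coefZ coefXn eqxx y1 scale1r red1 mulr1.
  rewrite big1 ?addr0 => [/eqP|i ii0]; first by rewrite oner_eq0.
  by rewrite coefZ coefXn val_eqE eq_sym (negPf ii0) mulr0.
rewrite (bigD1 t) //= rootM; apply/orP; left; apply/rootP.
have redX i : red u (x ^+ i) = red u x ^+ i.
  elim: i => [|i IHi]; first by rewrite !expr0 red1.
  by rewrite exprS redM // IHi exprS.
transitivity (red u (\sum_i (y i)%:A * x ^+ i)); last by rewrite rel red0.
rewrite PtE horner_sum red_sum => [|i]; last by rewrite valfM adde_ge0.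
by apply: eq_bigr => i _; rewrite hornerZ hornerXn redM // redX.
Qed.

End FiniteResidue.

(** * The quotient by inertia *)

Section Inertia.
Context {R : realType} {K : fieldType} {L : splittingFieldType K}.
Variables (u : valuation R L).
Hypothesis u_isom : forall (s : gal_of {:L}) x, u (s x) = u x.

Definition residue_aut (s : gal_of {:L}) (r : residue_field u) :
  residue_field u := red u (s (s2val (cid2 (red_surj r)))).

Lemma residue_aut_red s x : (0 <= u x)%E ->
  residue_aut s (red u x) = red u (s x).
Proof.
move=> x0; rewrite /residue_aut; case: cid2 => y /= y0 /esym/eqP.
rewrite red_eq // => yx; apply/eqP.
by rewrite red_eq ?u_isom // -rmorphB u_isom.
Qed.

Lemma residue_aut_zmod s : zmod_morphism (residue_aut s).
Proof.
move=> r1 r2; have [x x0 ->] := red_surj r1; have [y y0 ->] := red_surj r2.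
rewrite -redB // !residue_aut_red ?rmorphB ?redB ?u_isom //.
exact: valfB_ge.
Qed.

Lemma residue_aut_monoid s : monoid_morphism (residue_aut s).
Proof.
split=> [|r1 r2]; first by rewrite -(red1 u) residue_aut_red ?rmorph1 ?valf1.
have [x x0 ->] := red_surj r1; have [y y0 ->] := red_surj r2.
rewrite -redM // !residue_aut_red ?rmorphM ?redM ?u_isom //.
by rewrite valfM adde_ge0.
Qed.

(** The quotient by inertia acts faithfully on the residue field, and all
    automorphisms of a finite field are powers of one of them. *)
Lemma cyclic_mod_inertia (e : seq (residue_field u)) (eP : forall r, r \in e) :
  cyclic ('Gal({:L} / 1) / inertia_group u)%g.
Proof.
pose k := finField_of eP.
pose A s : {rmorphism k -> k} := HB.pack (residue_aut s : k -> k)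
  (GRing.isZmodMorphism.Build k k (residue_aut s) (residue_aut_zmod s))
  (GRing.isMonoidMorphism.Build k k (residue_aut s) (residue_aut_monoid s)).
apply: (cyclic_finField_action (act := A)) => [s t r|s].
  have [x x0 ->] := red_surj (r : residue_field u).
  rewrite /= (residue_aut_red _ x0) (residue_aut_red s x0).
  by rewrite residue_aut_red ?u_isom // galM ?memvf.
rewrite inE; congr (_ && _); apply/asboolP/forallP => [sI r | s1 x x0].
  have [x x0 ->] := red_surj (r : residue_field u).
  by rewrite /= (residue_aut_red _ x0) red_eq ?u_isom // sI.
have /= := s1 (red u x); rewrite residue_aut_red //.
by rewrite [X in is_true X -> _]red_eq ?u_isom.
Qed.

End Inertia.

(** * The Galois group of a fiber *)

Section Tower.
Context {R : realType} {K : fieldType} {L : splittingFieldType K}.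
Variables (u : valuation R L).
Hypothesis u_isom : forall (s : gal_of {:L}) x, u (s x) = u x.
Variables (l : nat) (zK : K) (e g : R) (c a : K) (n : nat) (fiber : seq L).
Let z : L := zK%:A.
Hypotheses (l_gt1 : (1 < l)%N) (z_prim : l.-primitive_root z).
Hypotheses (e_ge0 : 0 <= e)
  (e_gap : forall i, (0 < i < l)%N -> u (1 - z ^+ i) = e%:E).
Hypotheses (uc : u c%:A = g%:E) (g_lt : g < - (l%:R * e))
  (ua : (g%:E < u a%:A)%E).
Let f (x : L) := x ^+ l - c%:A.
Let rho := g / l%:R.
Hypotheses (fiberP : forall x, x \in fiber = (iter n f x == a%:A))
  (L_galois : galois 1 {:L}) (L_gen : <<1 & fiber>>%VS = {:L}%VS).

Let gal_alg (s : gal_of {:L}) (x : K) : s x%:A = x%:A.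
Proof. by rewrite linearZ /= rmorph1. Qed.

(** By rigidity the automorphisms fixing one point of the fiber fix all the
    others, which generate the whole field. *)
Lemma adjoin_fiber alpha : alpha \in fiber -> <<1; alpha>>%VS = {:L}%VS.
Proof.
move=> fib_alpha; apply/eqP; rewrite eqEsubv subvf -L_gen.
apply/Fadjoin_seqP; split; first exact: subv_adjoin.
move=> b fib_b.
have /galois_fixedField <- : galois <<1; alpha>> {:L}.
  by apply: galoisS L_galois; rewrite sub1v subvf.
apply/fixedFieldP => [|s sG]; first exact: memvf.
move: fib_alpha fib_b; rewrite !fiberP => /eqP fa /eqP fb.
apply: (fiber_rigid l_gt1 z_prim e_ge0 e_gap uc g_lt ua (s := s) _ _ _ _
  fa fb).
- exact: u_isom.
- exact: gal_alg.
- exact: gal_alg.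
- exact: gal_alg.
- by apply: fixed_gal sG _; rewrite ?subvf ?memv_adjoin.
Qed.

Lemma gal_fiber_eq1 alpha (s : gal_of {:L}) :
  alpha \in fiber -> s alpha = alpha -> s = 1%g.
Proof.
move=> fib_alpha s_alpha; apply/eqP/gal_eqP => x _; rewrite gal_id.
have : (<<1; alpha>> <= fixedField [set s])%VS.
  apply/FadjoinP; split; first exact: sub1v.
  by apply/fixedFieldP => [|t /set1P->]; rewrite ?memvf.
rewrite adjoin_fiber // => /subvP/(_ x (memvf x))/fixedFieldP.
by move=> /(_ (memvf x)) ->; rewrite ?set11.
Qed.

Variable alpha : L.
Hypothesis fib_alpha : alpha \in fiber.

(** The index is shifted by one because the point of level 0 is [a] itself,
    which every automorphism fixes. *)
Let anc (i : nat) : L := iter (n - i.+1) f alpha.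

Let ancP (i : 'I_n) : iter i.+1 f (anc i) = a%:A.
Proof.
by move: fib_alpha; rewrite fiberP /anc -iterD subnKC // => /eqP.
Qed.

Let u_anc (i : 'I_n) : u (anc i) = rho%:E.
Proof. exact: (valf_fiber l_gt1 e_ge0 uc g_lt ua (ancP i)). Qed.

Let anc_f (i : 'I_n) : f (anc i) = iter (n - i) f alpha.
Proof. by rewrite /anc -(subnSK (ltn_ord i)) iterS. Qed.

Let near (s : gal_of {:L}) (i : 'I_n) (k : nat) :=
  ((rho + e)%:E < u (s (anc i) - z ^+ k * anc i)%R)%E.

Let near_exists (s : gal_of {:L}) (i : 'I_n) : exists k : 'Z_l, near s i k.
Proof.
have s_iter m x : iter m f (s x) = s (iter m f x).
  elim: m => //= m ->; rewrite /f rmorphB rmorphXn; congr (_ - _).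
  exact/esym/gal_alg.
have s_anc : iter i.+1 f (s (anc i)) = a%:A by rewrite s_iter ancP gal_alg.
have [k kl near_k] :=
  fiber_close l_gt1 z_prim e_ge0 e_gap uc g_lt ua s_anc (ancP i).
by exists k%:R; rewrite /near val_Zp_nat // modn_small.
Qed.

Let digit s i : 'Z_l := xchoose (near_exists s i).

Let digitP s i : near s i (digit s i).
Proof. exact: (xchooseP (near_exists s i)). Qed.

Let zX k : (z ^+ k) ^+ l = 1.
Proof. by rewrite exprAC (prim_expr_order z_prim) expr1n. Qed.

Let near_inj s i (k m : 'Z_l) : near s i k -> near s i m -> k = m.
Proof.
move=> near_k near_m; apply/val_inj/eqP.
have kl (x : 'Z_l) : (x < l)%N by rewrite -[l in (_ < l)%N]Zp_cast.
rewrite -[val k](modn_small (kl k)) -[val m](modn_small (kl m)).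
rewrite -(eq_prim_root_expr z_prim); apply/eqP.
apply: (unity_gap_eq l_gt1 z_prim e_gap (u_anc i)) => //.
rewrite -(subrKA (s (anc i))); apply: valfD_gt => //.
by rewrite valfBC.
Qed.

Let zD (k m : 'Z_l) : z ^+ (k + m)%R = z ^+ k * z ^+ m.
Proof.
rewrite -exprD -[RHS](prim_expr_mod z_prim); congr (z ^+ _).
by rewrite -[X in _ = (_ %% X)%N](Zp_cast l_gt1).
Qed.

(** Reading off the root of unity closest to [s (anc i) / anc i] is
    multiplicative in [s], because automorphisms fix the roots of unity and
    preserve closeness. *)
Let digitM s t i : digit (s * t)%g i = digit s i + digit t i.
Proof.
apply: near_inj (digitP _ _) _; rewrite /near zD.
set k := z ^+ digit s i; set m := z ^+ digit t i.
have tk : t k = k by rewrite rmorphXn; congr (_ ^+ _); apply: gal_alg.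
rewrite galM ?memvf // -(subrKA (k * t (anc i))); apply: valfD_gt.
  by rewrite -{1}tk -rmorphM -rmorphB u_isom; apply: digitP.
rewrite -mulrA -mulrBr valfM (unity_val _ l_gt1 (zX _)) add0e.
exact: digitP.
Qed.

Let digit_rowM : {in 'Gal({:L} / 1)%g &,
  {morph (fun s => \row_i digit s i : 'rV['Z_l]_n) :
     s t / (s * t)%g >-> (s * t)%g}}.
Proof. by move=> s t _ _; apply/rowP => i; rewrite !mxE digitM. Qed.

Let digit_row := Morphism digit_rowM.


(** Injectivity: if all the digits of [s] vanish then, by induction on the
    level, [s] fixes every iterate of [alpha], in the end [alpha] itself, which
    generates the whole field. *)
Lemma gal_embeds : exists H : {group 'rV['Z_l]_n}, ('Gal({:L} / 1) \isog H)%g.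
Proof.
exists (digit_row @* 'Gal({:L} / 1))%G; apply: sub_isog => //.
apply/fintype.subsetP => s; rewrite inE => /andP[_].
rewrite !inE => /eqP/rowP digit0; apply/eqP.
apply: (gal_fiber_eq1 fib_alpha).
suff fix_anc m : (m <= n)%N -> s (iter (n - m) f alpha) = iter (n - m) f alpha.
  by have := fix_anc n (leqnn n); rewrite subnn.
elim: m => [_|m IHm lt_mn].
  by have := fib_alpha; rewrite subn0 fiberP => /eqP ->; rewrite gal_alg.
pose i := Ordinal lt_mn.
apply: (fixed_of_close l_gt1 z_prim e_gap (c := c%:A) _ (u_anc i)).
- exact: gal_alg.
- have sf : s (f (anc i)) = f (anc i).
    by rewrite anc_f; apply: IHm (ltnW lt_mn).
  exact: sf.
- have := digitP s i; have := digit0 i; rewrite !mxE => ->.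
  by rewrite /near expr0 mul1r.
Qed.

End Tower.

(** * Reduction to the Galois setting *)

Lemma rowZ_expg (l n : nat) (x : 'rV['Z_l]_n) : (1 < l)%N -> (x ^+ l = 1)%g.
Proof.
move=> l_gt1; rewrite FinRing.zmodXgE; apply/rowP => i.
by rewrite mulmxnE !mxE -mulr_natr pchar_Zp // mulr0.
Qed.

(** The order of a cyclic group is its exponent. *)
Lemma card_cyclic_quotient (gT rT : finGroupType) (G N : {group gT})
    (H : {group rT}) (l : nat) :
  (forall x : rT, x ^+ l = 1)%g -> (G \isog H)%g -> cyclic (G / N)%g ->
  (#|(G / N)%g| %| l)%N.
Proof.
move=> expl /isogP[h inj_h _] /cyclicP[X GNX].
have /morphimP[x Nx Gx XE] : X \in (G / N)%g by rewrite GNX cycle_id.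
rewrite GNX.
rewrite -/(#[X])%g order_dvdn XE -morphX //.
suff -> : (x ^+ l = 1)%g by rewrite morph1.
apply: (injmP inj_h); rewrite ?groupX ?group1 //.
by rewrite morphX // expl morph1.
Qed.

Section Iterates.
Variables (K F : fieldType) (h : {rmorphism K -> F}) (l : nat) (c : K).

Lemma horner_fiter n x :
  (map_poly h (fiter l c n)).[x] = iter n (fun y => y ^+ l - h c) x.
Proof.
elim: n => [|n IHn] /=; first by rewrite map_polyX hornerX.
rewrite map_comp_poly horner_comp -/(fiter l c n) IHn.
by rewrite rmorphB /= map_polyXn map_polyC !hornerE.
Qed.

End Iterates.

Lemma iter_unicrit_surj (F : closedFieldType) (l : nat) (c a : F) n :
  (0 < l)%N -> exists x, iter n (fun y => y ^+ l - c) x = a.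
Proof.
move=> l0; elim: n => [|n [y ya]]; first by exists a.
have [|x /rootP] := @closed_rootP F ('X^l - (y + c)%:P) _.
  by rewrite size_XnsubC // eqSS -lt0n.
rewrite !hornerE => /eqP; rewrite subr_eq0 => /eqP xl.
by exists x; rewrite iterSr xl addrK.
Qed.

(** Having a primitive root in the base field itself makes its powers fixed by
    all automorphisms. *)
Lemma prim_root_descends (K : fieldType) (F : closedFieldType)
    (h : {rmorphism K -> F}) l : (0 < l)%N -> l%:R != 0 :> K ->
  (forall z, l.-unity_root z -> exists x, z = h x) ->
  exists z : K, l.-primitive_root z.
Proof.
move=> l0 lK mu_l; have lF : l%:R != 0 :> F.
  by rewrite -(rmorph_nat h) fmorph_eq0.
have [rs rsE] := closed_field_poly_normal ('X^l - 1 : {poly F}).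
rewrite (monicP (monic_Xn_sub_1 _ l0)) scale1r in rsE.
have rs_uniq : uniq rs by rewrite -separable_prod_XsubC -rsE separable_Xn_sub_1.
have rs_unity : all l.-unity_root rs.
  by apply/allP => x rs_x; rewrite /root_of_unity rsE root_prod_XsubC.
have rs_size : (l <= size rs)%N.
  have := congr1 (fun q : {poly F} => size q) rsE.
  by rewrite size_prod_XsubC -polyC1 size_XnsubC // => -[->].
have /hasP[z rs_z z_prim] := has_prim_root l0 rs_unity rs_uniq rs_size.
have [x zE] := mu_l z (allP rs_unity z rs_z).
by exists x; rewrite -(fmorph_primitive_root h) -zE.
Qed.

(** Both the tame and the wild case enter the argument through this dichotomy
    alone: [l] has valuation 0, or it is prime. *)
Lemma valf_exponent (R : realType) (K : fieldType) (v : valuation R K) p l :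
  residue_char v p -> (1 < l)%N ->
  ~~ (p %| l)%N \/ l = p /\ v p%:R = 1%:E ->
  exists lv, [/\ v l%:R = lv%:E, 0 <= lv & lv = 0 \/ prime l].
Proof.
move=> v_char l_gt1 [p_l|[lp vp]]; last first.
  exists 1; rewrite lp vp ler01; split=> //; right.
  case: v_char => [[p0 _]|/pcharf_prime //].
  by rewrite lp p0 in l_gt1.
exists 0; split=> //; last by left.
have red_nat m : red v m%:R = m%:R.
  elim: m => [|m IHm]; first exact: red0.
  by rewrite !mulrSr redD ?valf_nat ?valf1 // IHm red1.
apply/eqP; rewrite eq_le valf_nat andbT leNgt -red_eq0 ?valf_nat // red_nat.
case: v_char => [[_ char0]|char_p].
  have /pcharf0P -> : [pchar (residue_field v)] =i pred0 := char0.
  by rewrite -lt0n ltnW.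
by rewrite -(@dvdn_pcharf (residue_field v) _ char_p).
Qed.

Theorem theorem4p2
  (R : realType) (K : fieldType) (v : valuation R K) (p : nat)
  (v_complete : complete v) (v_discrete : discrete v)
  (v_char : residue_char v p)
  (* an algebraic closure of K, with an extension w of v *)
  (Kbar : closedFieldType) (iota : {rmorphism K -> Kbar})
  (Kbar_algebraic : forall z : Kbar, algebraicOver iota z)
  (w : valuation R Kbar) (w_extends : forall x : K, w (iota x) = v x)
  (l : nat) (c a : K) (l_ge2 : (2 <= l)%N) (c_neq0 : c != 0)
  (tame_or_wild :
     ~~ (p %| l)%N \/ [/\ l = p, finite_ext_Qp R p K & v p%:R = 1%:E])
  (distinct : forall m : nat,
     exists2 s : seq Kbar, uniq s &
       map_poly iota (fiter l c m - a%:P) = \prod_(z <- s) ('X - z%:P))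
  (v_c : (v c < nu_infty v l)%E) (v_a : (v c < v a)%E)
  (mu_l : forall z : Kbar, l.-unity_root z -> exists x : K, z = iota x)
  (n : nat)
  (* the subfield Kn of Kbar generated over K by the solutions of f^n(z) = a *)
  (Kn : splittingFieldType K) (j : {rmorphism Kn -> Kbar})
  (j_iota : forall x : K, j x%:A = iota x)
  (fiber : seq Kn)
  (fiberP : forall z : Kbar,
     ((map_poly iota (fiter l c n)).[z] == iota a) = (z \in map j fiber))
  (Kn_gen : <<1 & fiber>>%VS = {:Kn}%VS) :
  let G := 'Gal({:Kn} / 1)%G in
  let I := inertia_group (restrict w j) in
  [/\ exists H : {group 'rV['Z_l]_n}, (G \isog H)%g,
      finite_set [set: residue v] ->
        cyclic (G / I)%g /\ (#|(G / I)%g| %| l)%N &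
      forall alpha : Kn, alpha \in fiber -> <<1; alpha>>%VS = {:Kn}%VS].
Proof.
move=> G I.
pose u := restrict w j.
have u_ext x : u x%:A = v x by rewrite /= j_iota w_extends.
have u_isom (s : gal_of {:Kn}) x : u (s x) = u x.
  have s_ext y : restrict u s y%:A = v y.
    rewrite -[RHS]u_ext; congr (u _); rewrite -[LHS]/(s _).
    by rewrite linearZ /= rmorph1.
  exact: (extension_unique v_complete s_ext u_ext).
have [lv [v_l lv_ge0 tame_lv]] :
    exists lv, [/\ v l%:R = lv%:E, 0 <= lv & lv = 0 \/ prime l].
  apply: valf_exponent v_char l_ge2 _.
  by case: tame_or_wild => [|[]]; [left | right].
have l_neq0 : l%:R != 0 :> K by apply: contra_eq_neq v_l => ->; rewrite valf0.
have [z z_prim] := prim_root_descends (ltnW l_ge2) l_neq0 mu_l.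
have zA_prim : l.-primitive_root (z%:A : Kn).
  by rewrite (fmorph_primitive_root (in_alg Kn)).
have u_l : u l%:R = lv%:E by rewrite -v_l -u_ext scaler_nat.
have e_gap := valf_one_sub_unity l_ge2 zA_prim u_l tame_lv.
have l1_gt0 : 0 < l%:R - 1 :> R by rewrite subr_gt0 ltr1n.
have e_ge0 : 0 <= lv / (l%:R - 1) by rewrite divr_ge0 // ltW.
have [g v_cE] := valf_fin v c_neq0.
have u_c : u c%:A = g%:E by rewrite -v_cE; apply: u_ext.
have g_lt : g < - (l%:R * (lv / (l%:R - 1))).
  move: v_c; rewrite v_cE /nu_infty v_l -EFinM lte_fin mulNr.
  by rewrite mulrAC mulrA.
have u_a : (g%:E < u a%:A)%E by rewrite [X in (_ < X)%E]u_ext -v_cE.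
pose f (x : Kn) := x ^+ l - c%:A.
have j_iter m x : j (iter m f x) = iter m (fun y => y ^+ l - iota c) (j x).
  by elim: m => //= m <-; rewrite /f rmorphB rmorphXn j_iota.
have fibP x : x \in fiber = (iter n f x == a%:A).
  rewrite -(mem_map (fmorph_inj j)) -fiberP horner_fiter -j_iter -j_iota.
  by rewrite (inj_eq (fmorph_inj j)).
have [alpha fib_alpha] : exists alpha, alpha \in fiber.
  have [y ya] := iter_unicrit_surj (iota c) (iota a) n (ltnW l_ge2).
  have /mapP[alpha fib_alpha _] : y \in map j fiber.
    by rewrite -fiberP horner_fiter ya.
  by exists alpha.
have Kn_galois : galois 1 {:Kn}.
  rewrite /galois sub1v normalFieldf andbT -Kn_gen.
  apply/separable_Fadjoin_seq/allP => x fib_x; apply/separable_elementP.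
  pose q := fiter l c n - a%:P.
  exists (map_poly (in_alg Kn) q); split; first exact: alg_polyOver.
    apply/rootP; rewrite rmorphB /= map_polyC hornerD hornerN hornerC.
    rewrite horner_fiter; move: fib_x; rewrite fibP => /eqP ->.
    by rewrite subrr.
  rewrite -(separable_map j) -map_poly_comp.
  have -> : map_poly (j \o in_alg Kn) q = map_poly iota q.
    by apply: eq_map_poly => y /=; rewrite j_iota.
  have [s s_uniq ->] := distinct n.
  by rewrite separable_prod_XsubC.
have [H GH] := gal_embeds u_isom l_ge2 zA_prim e_ge0 e_gap u_c g_lt u_a fibP
  Kn_galois Kn_gen fib_alpha.
split; first by exists H.
- move=> /(finite_residue_ext u_ext)[rs rs_all].
  have GI_cyclic : cyclic (G / I)%g := cyclic_mod_inertia u_isom rs_all.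
  split=> //; apply: card_cyclic_quotient GH GI_cyclic => x.
  exact: rowZ_expg.
- move=> b; exact: (adjoin_fiber u_isom l_ge2 zA_prim e_ge0 e_gap u_c g_lt u_a
    fibP Kn_galois Kn_gen).
Qed.
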